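(* Let $(\rho_k)_{k}$ be a sequence in $\mathcal R$ and let $\rho\in\mathcal R$. For every $k$, $$\|Q_{\rho_k}-Q_\rho\|_{\mathrm{op}}=\|\mathbf 1_{E_{\rho_k}}-\mathbf 1_{E_\rho}\|_\infty\in\{0,1\}.$$ Consequently, $Q_{\rho_k}\to Q_\rho$ in operator norm if and only if $E_{\rho_k}=E_\rho$ almost everywhere (i.e. up to a $\lambda$-null set) for all sufficiently large $k$.
   Context: Let $X=\mathbb R^n$ ($n\ge 1$) with its Borel $\sigma$-algebra and Lebesgue measure $\lambda$; functions are complex-valued. Let $\mathcal H=L^2(X,\lambda)$ and $\mathcal R=\{\rho\in L^1(X,\lambda):\rho\ge 0\ \lambda\text{-a.e.},\ \int_X\rho\,d\lambda=1\}$. For $\rho\in\mathcal R$ let $E_\rho=\{\rho>0\}$ (defined up to null sets) and let $Q_\rho\in\mathcal B(\mathcal H)$ be the orthogonal projection $Q_\rho u=\mathbf 1_{E_\rho}u$. $\|\cdot\|_{\mathrm{op}}$ is the operator norm on $\mathcal B(\mathcal H)$ and $\|\cdot\|_\infty$ is the norm of $L^\infty(X,\lambda)$. *)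

(* Defs.v *)
From HB Require Import structures.
From mathcomp Require Import all_boot all_order all_algebra.
From mathcomp Require Import all_classical all_reals all_analysis.
From mathcomp Require Import measurable_realfun.
From mathcomp Require Import complex.
Set Implicit Arguments.
Unset Strict Implicit.
Unset Printing Implicit Defensive.
Import Order.TTheory GRing.Theory Num.Theory.
Import numFieldNormedType.Exports.
Local Open Scope classical_set_scope.
Local Open Scope ring_scope.

Local Notation normc := (@ComplexField.Normc.normc _).

(* R^n is n.-tuple R; its sigma-algebra in the library is the one generated by
   the coordinates, that is, the Borel sigma-algebra of R^n since R is second
   countable. *)
Section lebesgue_tuple.
Context {R : realType}.
Local Notation Rn n := (n.-tuple (measurableTypeR R)).

Definition tuple_cons n (p : measurableTypeR R * Rn n) : Rn n.+1 :=
  [tuple of p.1 :: p.2].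

Definition tuple_uncons n (t : Rn n.+1) : measurableTypeR R * Rn n :=
  (thead t, [tuple of behead t]).

Lemma tuple_consK n : cancel (@tuple_cons n) (@tuple_uncons n).
Proof.
move=> [x t]; rewrite /tuple_uncons /tuple_cons /=; congr pair.
exact/val_inj.
Qed.

Lemma tuple_unconsK n : cancel (@tuple_uncons n) (@tuple_cons n).
Proof. by move=> t; rewrite [RHS]tuple_eta. Qed.

Lemma measurable_tuple_cons n : measurable_fun setT (@tuple_cons n).
Proof. exact: measurable_cons measurable_fst measurable_snd. Qed.

Lemma measurable_tuple_uncons n : measurable_fun setT (@tuple_uncons n).
Proof.
apply/measurable_fun_pair; first exact: measurable_tnth.
exact: measurable_behead.
Qed.

Section step.
Variables (n : nat) (m : {sigma_finite_measure set (Rn n) -> \bar R}).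

Definition lebesgue_step : set (Rn n.+1) -> \bar R :=
  pushforward (lebesgue_measure \x m)%E (@tuple_cons n).

Let lebesgue_step0 : lebesgue_step set0 = 0%E.
Proof. by rewrite /lebesgue_step /pushforward preimage_set0 measure0. Qed.

Let lebesgue_step_ge0 A : (0 <= lebesgue_step A)%E.
Proof. by rewrite /lebesgue_step /pushforward; exact: measure_ge0. Qed.

Let lebesgue_step_sigma_additive : semi_sigma_additive lebesgue_step.
Proof.
move=> F mF tF mUF; rewrite /lebesgue_step /pushforward preimage_bigcup.
apply: measure_semi_sigma_additive.
- by move=> k; rewrite -[X in measurable X]setTI; exact: measurable_tuple_cons.
- apply/trivIsetP => /= i j _ _ ij; rewrite -preimage_setI.
  by move/trivIsetP : tF => /(_ _ _ _ _ ij) ->//; rewrite preimage_set0.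
- rewrite -preimage_bigcup -[X in measurable X]setTI.
  exact: measurable_tuple_cons.
Qed.

HB.instance Definition _ := isMeasure.Build _ _ _ lebesgue_step
  lebesgue_step0 lebesgue_step_ge0 lebesgue_step_sigma_additive.

Let lebesgue_step_sigma_finite : sigma_finite setT lebesgue_step.
Proof.
have /sigma_finiteP[F [FT ndF Foo]] := sigma_finiteT (@lebesgue_measure R).
have /sigma_finiteP[G [GT ndG Goo]] := sigma_finiteT m.
exists (fun k => @tuple_uncons n @^-1` (F k `*` G k)).
  rewrite -preimage_bigcup -[LHS](preimage_setT (@tuple_uncons n)).
  congr (_ @^-1` _); rewrite -setXTT FT GT predeqE => -[x y]; split.
    move=> [/= [i _ Fix] [j _ Gjy]]; exists (maxn i j) => //; split.
    - by move: x Fix; exact/subsetPset/ndF/leq_maxl.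
    - by move: y Gjy; exact/subsetPset/ndG/leq_maxr.
  by move=> [i _ []/= ? ?]; split; exists i.
move=> k; have [mF Fk] := Foo k; have [mG Gk] := Goo k; split.
  rewrite -[X in measurable X]setTI; apply: measurable_tuple_uncons => //.
  exact: measurableX.
rewrite /lebesgue_step /pushforward -comp_preimage.
rewrite (_ : _ \o _ = id); last by apply/funext => p /=; rewrite tuple_consK.
rewrite preimage_id.
by rewrite product_measure1E// lte_mul_pinfty// ge0_fin_numE.
Qed.

HB.instance Definition _ :=
  Measure_isSigmaFinite.Build _ _ _ lebesgue_step lebesgue_step_sigma_finite.

End step.

(* lambda_(n+1) is the image of lambda_1 \x lambda_n under (x, t) |-> x :: t;
   lebesgue_tuple_box below gives its value on boxes, which determines it. *)
Fixpoint lebesgue_tuple n : {sigma_finite_measure set (Rn n) -> \bar R} :=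
  if n is m.+1 then lebesgue_step (lebesgue_tuple m)
  else \d_([tuple] : Rn 0).

Lemma lebesgue_tuple_box n (a b : 'I_n -> R) : (forall i, a i <= b i) ->
  lebesgue_tuple n [set t | forall i, tnth t i \in `]a i, b i]] =
    (\prod_(i < n) (b i - a i))%:E.
Proof.
elim: n a b => [|n IH] a b ab.
  rewrite big_ord0 /= diracE mem_set//.
  by case.
rewrite big_ord_recl.
pose B := [set t : Rn n | forall i,
  tnth t i \in `]a (lift ord0 i), b (lift ord0 i)]].
have mB : measurable B.
  rewrite (_ : B = \bigcap_(i in [set: 'I_n])
      (fun t : Rn n => tnth t i) @^-1`
        [set` `]a (lift ord0 i), b (lift ord0 i)]]); last first.
    by apply/seteqP; split => t /= h i => [_|]; exact: h.
  apply: fin_bigcap_measurable => // i _.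
  by rewrite -[X in measurable X]setTI; exact: measurable_tnth.
rewrite /= /lebesgue_step /pushforward.
rewrite (_ : _ @^-1` _ = [set` `]a ord0, b ord0]] `*` B); last first.
  apply/seteqP; split => -[x t] /=.
    move=> h; split; first by have := h ord0; rewrite tnth0.
    by move=> i; have := h (lift ord0 i); rewrite tnthS.
  by move=> [h1 h2] i; case: (unliftP ord0 i) => [j|] ->; rewrite ?tnth0 ?tnthS.
rewrite product_measure1E// IH//.
rewrite EFinM; congr (_ * _)%E.
rewrite [LHS](lebesgue_measure_itv `]a ord0, b ord0])/= lte_fin.
have := ab ord0; rewrite le_eqVlt => /predU1P[->|->]; last by rewrite EFinB.
by rewrite ltxx subrr.
Qed.

End lebesgue_tuple.

Section L2_functions.
Context {d} {T : measurableType d} {R : realType}.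
Variable mu : {measure set T -> \bar R}.
Implicit Types u v : T -> R[i].

Definition cmeasurable_fun u :=
  measurable_fun setT (@complex.Re R \o u) /\
  measurable_fun setT (@complex.Im R \o u).

Definition L2norm u : \bar R :=
  ('N[mu]_2%:E[EFin \o (normc \o u)])%E.

Definition square_integrable : {pred T -> R[i]} :=
  mem [set u | cmeasurable_fun u /\ (L2norm u < +oo)%E].

Lemma square_integrableP u :
  reflect (cmeasurable_fun u /\ (L2norm u < +oo)%E) (u \in square_integrable).
Proof. by apply: (iffP idP); rewrite inE. Qed.

Lemma normc_ge0 (z : R[i]) : 0 <= normc z.
Proof. by case: z => a b; exact: sqrtr_ge0. Qed.

Lemma measurable_normc u :
  cmeasurable_fun u -> measurable_fun setT (normc \o u).
Proof.
move=> [mr mi].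
rewrite (_ : _ \o _ = @Num.sqrt R \o (fun x =>
  complex.Re (u x) ^+ 2 + complex.Im (u x) ^+ 2)); last first.
  by apply/funext => x /=; case: (u x).
apply: measurableT_comp.
  exact: continuous_measurable_fun (@sqrt_continuous R).
by apply: measurable_funD; exact: measurable_funX.
Qed.

Lemma L2norm_ge0 u : (0 <= L2norm u)%E.
Proof. exact: Lnorm_ge0. Qed.

Lemma le_L2norm u v : cmeasurable_fun u -> cmeasurable_fun v ->
  {ae mu, forall x, normc (u x) <= normc (v x)} -> (L2norm u <= L2norm v)%E.
Proof.
move=> mu_ mv uv; rewrite /L2norm unlock /Lnorm.
have m2 w : cmeasurable_fun w ->
    measurable_fun setT (fun x => `|(EFin \o (normc \o w)) x| `^ 2)%E.
  move=> mw.
  apply: (measurableT_comp (measurable_poweR _)).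
  apply/measurableT_comp => //; apply/measurable_EFinP.
  exact: measurable_normc.
rewrite gt0_ler_poweR//.
- by rewrite in_itv/= leey integral_ge0// => x _; exact: poweR_ge0.
- by rewrite in_itv/= leey integral_ge0// => x _; exact: poweR_ge0.
apply: ae_ge0_le_integral => //.
- by move=> x _; exact: poweR_ge0.
- exact: m2.
- by move=> x _; exact: poweR_ge0.
- exact: m2.
apply: filterS uv => x uvx _ /=.
rewrite lee_fin ge0_ler_powR ?nnegrE ?normr_ge0//.
by rewrite !ger0_norm ?normc_ge0.
Qed.

Lemma eq_L2norm u v : cmeasurable_fun u -> cmeasurable_fun v ->
  {ae mu, forall x, u x = v x} -> L2norm u = L2norm v.
Proof.
move=> mu_ mv uv; apply/eqP; rewrite eq_le !le_L2norm//.
  by apply: filterS uv => x ->.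
by apply: filterS uv => x ->.
Qed.

Lemma cmeasurable_funD u v :
  cmeasurable_fun u -> cmeasurable_fun v -> cmeasurable_fun (u + v).
Proof.
move=> [ur ui] [vr vi]; split.
  rewrite (_ : _ \o _ = (@complex.Re R \o u) \+ (@complex.Re R \o v))%R.
    exact: measurable_funD.
  by apply/funext => x; rewrite /= fctE; case: (u x) (v x) => [? ?] [? ?].
rewrite (_ : _ \o _ = (@complex.Im R \o u) \+ (@complex.Im R \o v))%R.
  exact: measurable_funD.
by apply/funext => x; rewrite /= fctE; case: (u x) (v x) => [? ?] [? ?].
Qed.

Lemma L2normD u v : cmeasurable_fun u -> cmeasurable_fun v ->
  (L2norm (u + v)%R <= L2norm u + L2norm v)%E.
Proof.
move=> mu_ mv.
pose w : T -> R[i] := fun x => (normc (u x) + normc (v x))%:C%C.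
have mw : cmeasurable_fun w.
  split; last exact: measurable_cst.
  exact: measurable_funD (measurable_normc mu_) (measurable_normc mv).
have nw : normc \o w = (normc \o u) \+ (normc \o v).
  apply/funext => x /=; rewrite expr0n addr0 sqrtr_sqr ger0_norm//.
  by rewrite addr_ge0// normc_ge0.
apply: (@le_trans _ _ (L2norm w)).
  apply: le_L2norm => //; first exact: cmeasurable_funD.
  apply: nearW => x; rewrite -[leRHS]/((normc \o w) x) nw/=.
  exact: le_normcD.
rewrite /L2norm nw; apply: minkowski_EFin => //.
- exact: measurable_normc.
- exact: measurable_normc.
- by rewrite ler1n.
Qed.

Lemma cmeasurable_funZ (c : R[i]) u :
  cmeasurable_fun u -> cmeasurable_fun (c *: u).
Proof.
case: c => a b [ur ui]; split.
  rewrite (_ : _ \o _ = (fun x => a * (@complex.Re R \o u) x -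
    b * (@complex.Im R \o u) x)).
    by apply: measurable_funB; exact: measurable_funM.
  by apply/funext => x; rewrite /= fctE; case: (u x) => ? ?.
rewrite (_ : _ \o _ = (fun x => a * (@complex.Im R \o u) x +
  b * (@complex.Re R \o u) x)).
  by apply: measurable_funD; exact: measurable_funM.
by apply/funext => x; rewrite /= fctE; case: (u x) => ? ?.
Qed.

Lemma square_integrable_submod : submod_closed square_integrable.
Proof.
split.
  apply/square_integrableP; split; first by split; exact: measurable_cst.
  rewrite /L2norm (_ : EFin \o _ = cst 0%E) ?Lnorm0//.
  by apply/funext => x /=; rewrite expr0n addr0 sqrtr0.
move=> c u v /square_integrableP[mu_ uoo] /square_integrableP[mv voo].
have mcu := cmeasurable_funZ c mu_.
apply/square_integrableP; split; first exact: cmeasurable_funD.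
apply: (le_lt_trans (L2normD _ _)) => //; rewrite lte_add_pinfty//.
rewrite /L2norm.
rewrite (_ : _ \o (_ \o _) = EFin \o (normc c \o* (normc \o u))); last first.
  by apply/funext => x /=; rewrite ComplexField.Normc.normcM mulrC.
suff : normc c \o* (normc \o u) \in Lfun mu 2%:E.
  by rewrite inE => /andP[_]; rewrite inE.
apply: Lfun_scale; first by rewrite ler1n.
by rewrite inE; apply/andP; split; rewrite inE//; exact: measurable_normc.
Qed.

HB.instance Definition _ := GRing.isSubmodClosed.Build _ _ square_integrable
  square_integrable_submod.

(* Square-integrable functions, before identification up to null sets. *)
Record L2fun := MkL2fun {
  L2fun_val :> T -> R[i];
  L2funP : L2fun_val \in square_integrable }.

HB.instance Definition _ := [isSub for L2fun_val].
HB.instance Definition _ := [Choice of L2fun by <:].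
HB.instance Definition _ := [SubChoice_isSubLmodule of L2fun by <:].

End L2_functions.

Section L2_space.
Context {d} {T : measurableType d} {R : realType}.
Variable mu : {measure set T -> \bar R}.
Local Notation F2 := (L2fun mu).
Implicit Types u v w : F2.

Definition ae_eq_L2 u v := `[< {ae mu, forall x, u x = v x} >].

Let ae_eq_L2_refl : reflexive ae_eq_L2.
Proof. by move=> u; apply/asboolP; apply: nearW. Qed.

Let ae_eq_L2_sym : symmetric ae_eq_L2.
Proof.
by move=> u v; apply/asboolP/asboolP; apply: filterS => x ->.
Qed.

Let ae_eq_L2_trans : transitive ae_eq_L2.
Proof.
move=> v u w /asboolP uv /asboolP vw; apply/asboolP.
by apply: filterS2 uv vw => x -> ->.
Qed.

Canonical ae_eq_L2_equiv :=
  EquivRel ae_eq_L2 ae_eq_L2_refl ae_eq_L2_sym ae_eq_L2_trans.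

Local Open Scope quotient_scope.

(* The complex Hilbert space L^2(T, mu): classes of square-integrable functions
   modulo equality mu-a.e. *)
Definition L2 : Type := {eq_quot ae_eq_L2}.
HB.instance Definition _ := Choice.on L2.
HB.instance Definition _ := EqQuotient.on L2.

Implicit Types f g h : L2.

Lemma L2W (P : L2 -> Prop) : (forall u, P (\pi_L2 u)) -> forall f, P f.
Proof. by move=> Ppi f; rewrite -[f]reprK; exact: Ppi. Qed.

Lemma pi_L2_eq u v : {ae mu, forall x, u x = v x} <-> \pi_L2 u = \pi_L2 v.
Proof.
by split=> [uv|/eqmodP/asboolP//]; apply/eqmodP/asboolP.
Qed.

Lemma repr_pi_L2 u : {ae mu, forall x, (repr (\pi_L2 u) : F2) x = u x}.
Proof. by apply/pi_L2_eq; rewrite reprK. Qed.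

Definition L2_add f g : L2 := \pi_L2 (repr f + repr g).
Definition L2_opp f : L2 := \pi_L2 (- repr f).
Definition L2_scale (c : R[i]) f : L2 := \pi_L2 (c *: repr f).

Let pi_L2D u v : L2_add (\pi_L2 u) (\pi_L2 v) = \pi_L2 (u + v).
Proof.
apply/pi_L2_eq; apply: filterS2 (repr_pi_L2 u) (repr_pi_L2 v) => x.
by rewrite /= !fctE => -> ->.
Qed.

Let pi_L2N u : L2_opp (\pi_L2 u) = \pi_L2 (- u).
Proof.
by apply/pi_L2_eq; apply: filterS (repr_pi_L2 u) => x; rewrite /= !fctE => ->.
Qed.

Let pi_L2Z c u : L2_scale c (\pi_L2 u) = \pi_L2 (c *: u).
Proof.
by apply/pi_L2_eq; apply: filterS (repr_pi_L2 u) => x; rewrite /= !fctE => ->.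
Qed.

Let L2_addA : associative L2_add.
Proof. move=> f g h; elim/L2W: f => u; elim/L2W: g => v; elim/L2W: h => w.
by rewrite !pi_L2D addrA. Qed.
Let L2_addC : commutative L2_add.
Proof.
by move=> f g; elim/L2W: f => u; elim/L2W: g => v; rewrite !pi_L2D addrC.
Qed.
Let L2_add0 : left_id (\pi_L2 0) L2_add.
Proof. by move=> f; elim/L2W: f => u; rewrite !pi_L2D add0r. Qed.
Let L2_addN : left_inverse (\pi_L2 0) L2_opp L2_add.
Proof. by move=> f; elim/L2W: f => u; rewrite pi_L2N !pi_L2D addNr. Qed.

HB.instance Definition _ :=
  GRing.isZmodule.Build L2 L2_addA L2_addC L2_add0 L2_addN.

Lemma L2_piD u v : \pi_L2 u + \pi_L2 v = \pi_L2 (u + v).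
Proof. exact: pi_L2D. Qed.

Lemma L2_piN u : - \pi_L2 u = \pi_L2 (- u).
Proof. exact: pi_L2N. Qed.

Let L2_scaleA a b f : L2_scale a (L2_scale b f) = L2_scale (a * b) f.
Proof. by elim/L2W: f => ?; rewrite !pi_L2Z scalerA. Qed.
Let L2_scale1 : left_id 1 L2_scale.
Proof. by move=> f; elim/L2W: f => u; rewrite !pi_L2Z scale1r. Qed.
Let L2_scaleDr : right_distributive L2_scale +%R.
Proof.
move=> c f g; elim/L2W: f => u; elim/L2W: g => v.
by rewrite L2_piD !pi_L2Z L2_piD scalerDr.
Qed.
Let L2_scaleDl f : {morph L2_scale^~ f : a b / a + b}.
Proof. by move=> a b; elim/L2W: f => ?; rewrite !pi_L2Z L2_piD scalerDl. Qed.

HB.instance Definition _ := GRing.Zmodule_isLmodule.Build R[i] L2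
  L2_scaleA L2_scale1 L2_scaleDr L2_scaleDl.

Lemma L2_piZ c u : c *: \pi_L2 u = \pi_L2 (c *: u).
Proof. exact: pi_L2Z. Qed.

Definition L2_norm f : R := fine (L2norm mu (repr f)).

Lemma L2_norm_pi u : (L2_norm (\pi_L2 u))%:E = L2norm mu u.
Proof.
have /square_integrableP[mu_ uoo] := L2funP u.
have /square_integrableP[mv _] := L2funP (repr (\pi_L2 u)).
rewrite /L2_norm (eq_L2norm mv mu_ (repr_pi_L2 u)) fineK//.
by rewrite ge0_fin_numE ?L2norm_ge0.
Qed.

Lemma L2_norm_ge0 f : 0 <= L2_norm f.
Proof. by rewrite fine_ge0// L2norm_ge0. Qed.

Lemma L2_normB f g : L2_norm (f - g) <= L2_norm f + L2_norm g.
Proof.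
elim/L2W: f => u; elim/L2W: g => v.
have /square_integrableP[mu_ _] := L2funP u.
have /square_integrableP[mv _] := L2funP v.
have /square_integrableP[mNv _] := L2funP (- v).
rewrite -lee_fin EFinD L2_piN L2_piD !L2_norm_pi.
rewrite (le_trans (L2normD mu mu_ mNv))// leeD2l//.
apply: le_L2norm => //; apply: nearW => x.
by rewrite -[leLHS]/(normc (- v x)) normcN.
Qed.

Section mul_indic.
Variables (A : set T) (mA : measurable A).

Definition mul_indic_fun (u : T -> R[i]) : T -> R[i] :=
  fun x => (\1_A x)%:C%C * u x.

Lemma mul_indic_fun_square_integrable u :
  mul_indic_fun u \in square_integrable mu.
Proof.
have /square_integrableP[[ur ui] uoo] := L2funP u.
have m1 : cmeasurable_fun (mul_indic_fun u).
  split.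
    rewrite (_ : _ \o _ = (\1_A : T -> R) \* (@complex.Re R \o u)).
      exact: measurable_funM.
    apply/funext => x; rewrite /= /mul_indic_fun.
    by case: (u x) => a b /=; rewrite mul0r subr0.
  rewrite (_ : _ \o _ = (\1_A : T -> R) \* (@complex.Im R \o u)).
    exact: measurable_funM.
  apply/funext => x; rewrite /= /mul_indic_fun.
  by case: (u x) => a b /=; rewrite mul0r addr0.
apply/square_integrableP; split => //; apply: le_lt_trans uoo.
apply: le_L2norm => //; apply: nearW => x; rewrite /mul_indic_fun indicE.
by case: (_ \in _); rewrite ?mul1r// mul0r ComplexField.Normc.normc0 normc_ge0.
Qed.

Definition mul_indic u : F2 := MkL2fun (mul_indic_fun_square_integrable u).

Definition L2_mul_indic f : L2 := \pi_L2 (mul_indic (repr f)).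

Lemma L2_mul_indic_pi u : L2_mul_indic (\pi_L2 u) = \pi_L2 (mul_indic u).
Proof.
apply/pi_L2_eq; apply: filterS (repr_pi_L2 u) => x ux.
by rewrite /= /mul_indic_fun ux.
Qed.

Lemma L2_mul_indic_linear : linear L2_mul_indic.
Proof.
move=> c f g; elim/L2W: f => u; elim/L2W: g => v.
rewrite L2_piZ L2_piD !L2_mul_indic_pi L2_piZ L2_piD.
apply/pi_L2_eq; apply: nearW => x.
by rewrite /= /mul_indic_fun !fctE mulrDr; congr (_ + _); exact: mulrCA.
Qed.

Lemma L2_mul_indic_le f : L2_norm (L2_mul_indic f) <= L2_norm f.
Proof.
elim/L2W: f => u; rewrite L2_mul_indic_pi -lee_fin !L2_norm_pi.
have /square_integrableP[mu_ _] := L2funP u.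
have /square_integrableP[mv _] := L2funP (mul_indic u).
apply: le_L2norm => //; apply: nearW => x; rewrite /= /mul_indic_fun indicE.
by case: (_ \in _); rewrite ?mul1r// mul0r ComplexField.Normc.normc0 normc_ge0.
Qed.

End mul_indic.

Definition bounded_linear : {pred L2 -> L2} := mem [set F : L2 -> L2 |
  linear F /\ exists M : R, forall f, L2_norm (F f) <= M * L2_norm f].

Lemma bounded_linear_zmod : zmod_closed bounded_linear.
Proof.
split.
  rewrite inE; split; first by move=> c f g; rewrite scaler0 addr0.
  exists 0 => f; rewrite mul0r -lee_fin -[X in L2_norm X]/(\pi_L2 0) L2_norm_pi.
  rewrite /L2norm (_ : EFin \o _ = cst 0%E) ?Lnorm0//.
  by apply/funext => x /=; rewrite expr0n addr0 sqrtr0.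
move=> F G; rewrite !inE => -[lF [M FM]] [lG [N GN]]; split.
  move=> c f g; rewrite !fctE lF lG scalerBr.
  by rewrite opprD addrACA.
exists (M + N) => f; rewrite mulrDl (le_trans (L2_normB _ _))//.
exact: lerD.
Qed.

HB.instance Definition _ :=
  GRing.isZmodClosed.Build _ bounded_linear bounded_linear_zmod.

Record bounded_op := MkBoundedOp {
  bounded_op_val :> L2 -> L2;
  bounded_opP : bounded_op_val \in bounded_linear }.

HB.instance Definition _ := [isSub for bounded_op_val].
HB.instance Definition _ := [Choice of bounded_op by <:].
HB.instance Definition _ := [SubChoice_isSubZmodule of bounded_op by <:].

(* The set is nonempty and bounded above because F is bounded, so that sup is
   not a default value. *)
Definition opnorm (F : bounded_op) : R :=
  sup [set L2_norm (F f) | f in [set f | L2_norm f <= 1]].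

Definition op_cvg (F : nat -> bounded_op) (G : bounded_op) : Prop :=
  opnorm (F k - G) @[k --> \oo] --> (0 : R).

(* An element of the set of probability densities, given by one of its
   representatives; a.e. nonnegativity makes a real-valued one available. *)
Record density := MkDensity {
  density_val :> T -> R;
  density_L1 : density_val \in Lfun mu 1;
  density_ge0 : {ae mu, forall x, 0 <= density_val x};
  density_integral : (\int[mu]_x (density_val x)%:E = 1)%E }.

Definition positivity_set (rho : density) : set T := [set x | 0 < rho x].

Lemma measurable_positivity_set rho : measurable (positivity_set rho).
Proof.
have : measurable_fun setT rho.
  by have := density_L1 rho; rewrite inE => /andP[+ _]; rewrite inE.
move=> mrho; rewrite (_ : positivity_set _ = rho @^-1` `]0, +oo[).
  by rewrite -[X in measurable X]setTI; exact: mrho.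
by apply/seteqP; split => x; rewrite /= in_itv/= andbT.
Qed.

Lemma support_proj_bounded rho :
  L2_mul_indic (measurable_positivity_set rho) \in bounded_linear.
Proof.
rewrite inE; split; first exact: L2_mul_indic_linear.
by exists 1 => f; rewrite mul1r; exact: L2_mul_indic_le.
Qed.

(* The projection f |-> 1_{rho > 0} f on L^2. *)
Definition support_proj (rho : density) : bounded_op :=
  MkBoundedOp (support_proj_bounded rho).

End L2_space.

(* Main.v *)
(* The difference of the two projections is multiplication by 1_A - 1_B, whose
   modulus is the indicator of the symmetric difference D of the supports. If D
   is null the difference vanishes; otherwise it has norm at most 1 and is
   isometric on functions supported in D, and sigma-finiteness provides a unit
   vector there. The norms are thus in {0, 1}, so convergence to 0 means that
   they vanish eventually. *)
Require Import Defs.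
From HB Require Import structures.
From mathcomp Require Import all_boot all_order all_algebra.
From mathcomp Require Import all_classical all_reals all_analysis.
From mathcomp Require Import measurable_realfun ess_sup_inf complex.
Import Order.TTheory GRing.Theory Num.Theory.
Import numFieldNormedType.Exports.
Local Open Scope classical_set_scope.
Local Open Scope ring_scope.

Local Notation normc := (@ComplexField.Normc.normc _).

Section support_proj_sub.
Set Implicit Arguments.
Unset Strict Implicit.
Context {d} {T : measurableType d} {R : realType}.
Variable mu : {measure set T -> \bar R}.
Local Notation F2 := (L2fun mu).
Local Open Scope quotient_scope.
Implicit Types (A B : set T) (u : F2) (f : L2 mu) (r s : density mu).

Lemma L2_norm0 : L2_norm (0 : L2 mu) = 0.
Proof.
apply/EFin_inj; rewrite -[X in L2_norm X]/(\pi_(L2 mu) 0) L2_norm_pi /L2norm.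
rewrite (_ : EFin \o _ = cst 0%E) ?Lnorm0//.
by apply/funext => x /=; rewrite expr0n addr0 sqrtr0.
Qed.

(** If [A] met every set of a countable cover by finite-measure sets in a null set, it would be null
    itself. Finiteness is what later makes an indicator normalizable in L^2. *)
Lemma finite_measure_subset A : sigma_finite setT mu -> measurable A ->
  mu A != 0%E ->
  exists S, [/\ measurable S, S `<=` A, mu S != 0%E & (mu S < +oo)%E].
Proof.
move=> [F TF Foo] mA A0; apply: contrapT => noS; move/negP: A0; apply.
apply/eqP/(negligibleP mu mA).
have -> : A = \bigcup_k (A `&` F k) by rewrite -setI_bigcupr -TF setIT.
apply: negligible_bigcup => k; have [mF Fk] := Foo k.
have mAF : measurable (A `&` F k) by exact: measurableI.
apply/(negligibleP mu mAF); apply: contrapT => /eqP AF0.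
apply: noS; exists (A `&` F k); split => //.
by apply: le_lt_trans Fk; apply: le_measure => //; rewrite inE.
Qed.

Lemma unit_vector_supported A : measurable A -> mu A != 0%E ->
  (mu A < +oo)%E ->
  exists u, L2norm mu u = 1%E /\ forall x, ~ A x -> u x = 0.
Proof.
move=> mA A0 Aoo.
have muAfin : mu A \is a fin_num by rewrite ge0_fin_numE.
have a0 : 0 < fine (mu A) by rewrite fine_gt0// Aoo andbT lt0e A0 measure_ge0.
set a := fine (mu A) in a0.
(* The squared modulus of [w] is [a^-1] times the indicator of [A], which integrates to
   [a^-1 * a = 1]. *)
pose w x : R[i] := (Num.sqrt a^-1 * \1_A x)%:C%C.
have mw : cmeasurable_fun w.
  split; last exact: measurable_cst.
  by apply: measurable_funM; [exact: measurable_cst|exact: measurable_indic].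
have nw : L2norm mu w = 1%E.
  rewrite /L2norm unlock /Lnorm.
  under eq_integral => x _.
    rewrite (_ : (_ `^ _)%E = (a^-1)%:E * (\1_A x)%:E)%E; last first.
      rewrite /= expr0n addr0 sqrtr_sqr normr_id powR_mulrn ?normr_ge0//.
      rewrite real_normK ?num_real// exprMn sqr_sqrtr ?invr_ge0 ?ltW//.
      by rewrite indicE; case: (_ \in _); rewrite ?expr1n ?expr0n.
    over.
  rewrite ge0_integralZl//=.
  - rewrite integral_indic// setIT -(fineK muAfin) -/a -EFinM mulVf ?gt_eqF//.
    by rewrite poweR1r.
  - by apply/measurable_EFinP; exact: measurable_indic.
  - by rewrite lee_fin invr_ge0 ltW.
have wP : w \in square_integrable mu.
  by apply/square_integrableP; split => //; rewrite nw ltry.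
exists (MkL2fun wP); split => // x Ax.
by rewrite /= /w indicE memNset// mulr0.
Qed.

Lemma support_proj_sub_pi r s u :
  (support_proj r - support_proj s) (\pi_(L2 mu) u) =
  \pi_(L2 mu) (mul_indic (measurable_positivity_set r) u -
               mul_indic (measurable_positivity_set s) u).
Proof.
rewrite -[LHS]/(L2_mul_indic _ _ - L2_mul_indic _ _) !L2_mul_indic_pi.
by rewrite L2_piN L2_piD.
Qed.

Lemma measurable_setY A B :
  measurable A -> measurable B -> measurable (A `+` B).
Proof. by move=> mA mB; apply: measurableU; exact: measurableD. Qed.

Lemma normr_sub_indic A B x :
  `|\1_A x - \1_B x| = (\1_(A `+` B) x : R).
Proof.
rewrite /setY !indicE in_setU !in_setD; case: (x \in A); case: (x \in B) => /=;
  by rewrite ?subrr ?subr0 ?sub0r ?normrN ?normr0 ?normr1.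
Qed.

(** The exceptional set of the equivalence is exactly the symmetric difference; since it is
    measurable, negligible means of measure zero. *)
Lemma ae_iff_setY A B : measurable A -> measurable B ->
  {ae mu, forall x, A x <-> B x} <-> mu (A `+` B) = 0%E.
Proof.
move=> mA mB; rewrite -(negligibleP mu (measurable_setY mA mB)).
suff -> : A `+` B = ~` [set x | A x <-> B x] by [].
apply/seteqP; split => x /=; have [Ax|Ax] := pselect (A x);
  have [Bx|Bx] := pselect (B x); tauto.
Qed.

(** This pointwise identity serves three times: for the bound by 1, for the vanishing when the
    symmetric difference is null, and for the isometry on functions supported in it. *)
Lemma normc_mul_indic_sub A B (u : T -> R[i]) x :
  normc (mul_indic_fun A u x - mul_indic_fun B u x) =
  \1_(A `+` B) x * normc (u x).
Proof.
rewrite /mul_indic_fun -mulrBl ComplexField.Normc.normcM -normr_sub_indic.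
by congr (_ * _); rewrite /= oppr0 addr0 expr0n addr0 sqrtr_sqr.
Qed.

Lemma support_proj_sub_le r s f :
  L2_norm ((support_proj r - support_proj s) f) <= L2_norm f.
Proof.
elim/(@L2W _ _ _ mu): f => u; rewrite support_proj_sub_pi -lee_fin !L2_norm_pi.
set v := (X in (L2norm _ (L2fun_val X) <= _)%E).
have /square_integrableP[mu_ _] := L2funP u.
have /square_integrableP[mv _] := L2funP v.
apply: le_L2norm => //; apply: nearW => x.
rewrite /v normc_mul_indic_sub indicE.
by case: (_ \in _); rewrite ?mul1r// mul0r normc_ge0.
Qed.

Lemma opnorm_support_proj_sub_eq0 r s :
  mu (positivity_set r `+` positivity_set s) = 0%E ->
  opnorm (support_proj r - support_proj s) = 0.
Proof.
move=> /(ae_iff_setY (measurable_positivity_set r)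
  (measurable_positivity_set s)) rs.
have F0 f : (support_proj r - support_proj s) f = 0.
  elim/(@L2W _ _ _ mu): f => u; rewrite support_proj_sub_pi.
  apply/pi_L2_eq; apply: filterS rs => x rsx.
  apply: ComplexField.Normc.eq0_normc; rewrite normc_mul_indic_sub.
  rewrite indicE memNset ?mul0r//; rewrite /setY/=; tauto.
(* The zero vector lies in the unit ball, so the set of values is the singleton of 0 and its [sup]
   is a genuine one. *)
rewrite /opnorm (_ : [set _ | _ in _] = [set 0]) ?sup1//.
apply/seteqP; split => [_ [f _ <-]|_ ->].
  by rewrite F0 L2_norm0.
by exists 0; [rewrite /= L2_norm0|rewrite F0 L2_norm0].
Qed.

Lemma opnorm_support_proj_sub_eq1 r s : sigma_finite setT mu ->
  mu (positivity_set r `+` positivity_set s) != 0%E ->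
  opnorm (support_proj r - support_proj s) = 1.
Proof.
move=> sfmu D0.
have mD : measurable (positivity_set r `+` positivity_set s).
  by apply: measurable_setY; exact: measurable_positivity_set.
have [S [mS SD S0 Soo]] := finite_measure_subset sfmu mD D0.
have [u [u1 uS]] := unit_vector_supported mS S0 Soo.
have ub1 : ubound
    [set L2_norm ((support_proj r - support_proj s) f)
    | f in [set f : L2 mu | L2_norm f <= 1]] 1.
  by move=> _ [f f1 <-]; exact: le_trans (support_proj_sub_le _ _ _) f1.
have u1' : L2_norm (\pi_(L2 mu) u) = 1 by apply/EFin_inj; rewrite L2_norm_pi.
have Fu1 : L2_norm ((support_proj r - support_proj s) (\pi_(L2 mu) u)) = 1.
  apply/EFin_inj; rewrite support_proj_sub_pi L2_norm_pi -u1 /L2norm.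
  (* The moduli agree at every point: on [S] the indicator is 1 because [S] lies in the symmetric
     difference, and off [S] the function [u] is 0. *)
  congr Lnorm; apply/funext => x /=; congr EFin.
  rewrite [LHS]normc_mul_indic_sub.
  have [Sx|Sx] := pselect (S x).
    by rewrite indicE mem_set ?mul1r//; exact: SD.
  by rewrite uS// ComplexField.Normc.normc0 mulr0.
apply/eqP; rewrite eq_le /opnorm; apply/andP; split.
  by apply: ge_sup => //; exists 1, (\pi_(L2 mu) u) => //=; rewrite u1'.
by apply: ub_le_sup; [exists 1|exists (\pi_(L2 mu) u); rewrite //= u1'].
Qed.

Lemma Linfty_sub_indic A B : measurable A -> measurable B ->
  (0 < mu setT)%E ->
  'N[mu]_+oo [EFin \o (\1_A \- \1_B)%R]%E =
    ((mu (A `+` B) != 0%E)%:R : R)%:E.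
Proof.
(* The norm at exponent [+oo] is defined by cases on whether the whole space is null; [muT] selects
   the essential supremum. *)
move=> mA mB muT; rewrite unlock /Lnorm muT.
have mD := measurable_setY mA mB.
rewrite (_ : abse \o _ = EFin \o \1_(A `+` B)); last first.
  by apply/funext => x /=; rewrite normr_sub_indic.
have [D0|D0] := eqVneq (mu (A `+` B)) 0%E.
  apply: ess_sup_ae_cst => //; move/(negligibleP mu mD): D0.
  apply: negligibleS => x /=; apply: contra_notP => Dx.
  by rewrite indicE memNset.
apply/eqP; rewrite eq_le; apply/andP; split.
  apply/ess_supP; apply: nearW => x /=.
  by rewrite lee_fin indicE; case: (_ \in _).
(* An essential supremum below 1 would keep the indicator below 1 almost everywhere, making the
   symmetric difference null. *)
rewrite leNgt; apply/negP => lt1; move/negP : D0; apply; apply/eqP.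
apply/(negligibleP mu mD).
have := ess_sup_ge mu (EFin \o (\1_(A `+` B) : T -> R)).
apply: negligibleS => x Dx /=; apply/negP; rewrite -ltNge.
by rewrite indicE mem_set.
Qed.

(** On a null space the integral of a density would be 0 instead of 1. *)
Lemma density_measureT_gt0 r : (0 < mu setT)%E.
Proof.
rewrite lt0e measure_ge0 andbT; apply/eqP => muT0.
have := density_integral r; rewrite null_set_integral//.
  by move=> /eqP; rewrite eq_sym onee_eq0.
apply/measurable_EFinP.
by have := density_L1 r; rewrite inE => /andP[+ _]; rewrite inE.
Qed.

End support_proj_sub.

Theorem theorem8p2 (R : realType) (n : nat) (n_ge1 : (1 <= n)%N)
    (rho_ : nat -> density (@lebesgue_tuple R n))
    (rho : density (@lebesgue_tuple R n)) :
  (forall k : nat,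
     (opnorm (support_proj (rho_ k) - support_proj rho))%:E =
       'N[@lebesgue_tuple R n]_+oo
         [EFin \o (\1_(positivity_set (rho_ k)) \- \1_(positivity_set rho))%R]%E
     /\ (opnorm (support_proj (rho_ k) - support_proj rho) = 0 \/
         opnorm (support_proj (rho_ k) - support_proj rho) = 1)) /\
  (op_cvg (fun k => support_proj (rho_ k)) (support_proj rho) <->
   \forall k \near \oo, {ae @lebesgue_tuple R n, forall x,
     positivity_set (rho_ k) x <-> positivity_set rho x}).
Proof.
set mu := @lebesgue_tuple R n.
(* Both claims are read off this closed form, which the essential supremum norm shares. *)
have opnormE k : opnorm (support_proj (rho_ k) - support_proj rho) =
    (mu (positivity_set (rho_ k) `+` positivity_set rho) != 0%E)%:R.
  have [D0|D0] := eqVneq; first exact: opnorm_support_proj_sub_eq0.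
  by apply: opnorm_support_proj_sub_eq1 => //; exact: sigma_finiteT.
have aeP k := ae_iff_setY mu (measurable_positivity_set (rho_ k))
  (measurable_positivity_set rho).
split=> [k|].
  rewrite opnormE; split; last by case: (_ != _); [right|left].
  rewrite Linfty_sub_indic//; try exact: measurable_positivity_set.
  exact: density_measureT_gt0 rho.
(* Taking 1 as the tolerance suffices: a norm in {0, 1} that is below 1 is 0. *)
split=> [/cvgr0_norm_lt/(_ _ ltr01)|D0].
  apply: filterS => k; rewrite opnormE => nlt1; apply/aeP; move: nlt1.
  by case: eqVneq => //= _; rewrite normr1 ltxx.
(* Conversely, the sequence of norms is eventually constant, equal to 0. *)
apply: cvg_near_cst; apply: filterS D0 => k /aeP D0.
by rewrite opnormE D0 eqxx.
Qed.
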